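(* Let $\{P_j\}_{j\in\mathbb{N}_0}$ be a sequence of orthogonal projections in a Hilbert space $\mathscr{H}$. For $n\in\mathbb{N}_0$ set $$T_n=(1-P_n)(1-P_{n-1})\cdots(1-P_0),\qquad Q_n=P_n(1-P_{n-1})\cdots(1-P_0),$$ where $Q_0=P_0$. Then for all $n\in\mathbb{N}$ and all $x\in\mathscr{H}$, $$\|x\|^2=\|T_nx\|^2+\sum_{k=0}^{n}\|Q_kx\|^2 .$$ Hence $T_n\to 0$ in the strong operator topology as $n\to\infty$ if and only if $$I=\sum_{j\in\mathbb{N}_0}Q_j^*Q_j,$$ where this identity means precisely that $$\langle x,y\rangle=\sum_{j\in\mathbb{N}_0}\langle Q_jx,Q_jy\rangle\quad\text{for all }x,y\in\mathscr{H};$$ in particular, in that case, $\|x\|^2=\sum_{j\in\mathbb{N}_0}\|Q_jx\|^2$ for all $x\in\mathscr{H}$.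
   Context: $\mathbb{N}_0=\{0,1,2,\dots\}$ and $\mathbb{N}=\{1,2,\dots\}$. The symbol $1$ (or $I$) denotes the identity operator on $\mathscr{H}$. The projections $P_j$ are not assumed to commute. *)

(* Defs.v *)
From HB Require Import structures.
From mathcomp Require Import all_boot all_order all_algebra.
From mathcomp Require Import sesquilinear complex.
From mathcomp Require Import all_classical all_reals all_analysis.

Set Implicit Arguments.
Unset Strict Implicit.
Unset Printing Implicit Defensive.

Import Order.TTheory GRing.Theory Num.Theory.
Import numFieldNormedType.Exports.

Local Open Scope classical_set_scope.
Local Open Scope ring_scope.

(* Hilbert spaces may be real or complex: the scalar field K is either R with
   the identity as conjugation, or R[i] with complex conjugation. *)
Variant hilbert_scalars (R : realType) :
    forall K : numFieldType, (K -> K) -> Prop :=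
  | RealScalars : @hilbert_scalars R R (fun a => a)
  | ComplexScalars : @hilbert_scalars R R[i] (fun a => a^*).

(* The norm of H is the one induced by the inner product (which is linear in
   its first argument); completeness is part of completeNormedModType. *)
Definition hilbert_norm (K : numFieldType) (conj : K -> K)
    (H : completeNormedModType K) (dot : {dot H for conj}) : Prop :=
  forall x : H, `|x| ^+ 2 = dot x x.

(* P = P^2 = P^*.  Boundedness of P is not listed: it follows, since then
   |P x|^2 = <P x, x> <= |P x| |x|. *)
Definition orthogonal_projection (K : numFieldType) (conj : K -> K)
    (H : completeNormedModType K) (dot : {dot H for conj})
    (P : {linear H -> H}) : Prop :=
  (forall x : H, P (P x) = P x) /\
  (forall x y : H, dot (P x) y = dot x (P y)).

Section ProductsOfComplements.
Context (K : numFieldType) (H : completeNormedModType K).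
Variable P : nat -> {linear H -> H}.

(* (1 - P_{n-1}) ... (1 - P_0), with n factors; the identity for n = 0 *)
Fixpoint compl_prod (n : nat) (x : H) : H :=
  if n is m.+1 then compl_prod m x - P m (compl_prod m x) else x.

Definition T_op (n : nat) : H -> H := compl_prod n.+1.

Definition Q_op (n : nat) : H -> H := P n \o compl_prod n.

End ProductsOfComplements.

Definition strongly_tends_to_0 (K : numFieldType)
    (H : completeNormedModType K) (A : nat -> H -> H) : Prop :=
  forall x : H, A n x @[n --> \oo] --> (0 : H).

(* I = \sum_j A_j^* A_j, understood weakly:
   <x, y> = \sum_j <A_j x, A_j y> for all x and y. *)
Definition id_eq_sum_adjoint_mul (K : numFieldType) (conj : K -> K)
    (H : completeNormedModType K) (dot : {dot H for conj})
    (A : nat -> H -> H) : Prop :=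
  forall x y : H, series (fun j => dot (A j x) (A j y)) @ \oo --> dot x y.

(* Main.v *)
Require Import Defs.
From HB Require Import structures.
From mathcomp Require Import all_boot all_order all_algebra.
From mathcomp Require Import sesquilinear complex.
From mathcomp Require Import all_classical all_reals all_analysis.

Set Implicit Arguments.
Unset Strict Implicit.
Unset Printing Implicit Defensive.

Import Order.TTheory GRing.Theory Num.Theory.
Import numFieldNormedType.Exports.

Local Open Scope classical_set_scope.
Local Open Scope ring_scope.

(** A single projection splits the inner product into the parts of the two
vectors inside and outside its range,
[<x, y> = <x - P x, y - P y> + <P x, P y>].  Applying this successively to
the pairs [T_{n-1} x], [T_{n-1} y] makes the sum telescope
([dot_compl_prod]):
[<x, y> = <T_n x, T_n y> + \sum_(k <= n) <Q_k x, Q_k y>],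
without any commutation of the projections.  The diagonal [x = y] is the norm
identity.

The remainder of the series [\sum_k <Q_k x, Q_k y>] is thus exactly
[<T_n x, T_n y>].  If [T_n -> 0] strongly, Cauchy-Schwarz makes this remainder
vanish; conversely, convergence on the diagonal says that [|T_n x|^2 -> 0].
Working with the sesquilinear identity from the start gives the weak identity
for all pairs [x], [y] directly, so that no polarization is required and real
and complex scalars are treated alike: besides the hermitian symmetry of the
inner product, Cauchy-Schwarz only uses [a * conj a = |a|^2]. *)

Lemma mul_conj_hilbert_scalars (R : realType) (K : numFieldType)
    (conj : K -> K) :
  hilbert_scalars R conj -> forall a : K, a * conj a = `|a| ^+ 2.
Proof. by case=> a; rewrite ?normCK // -expr2 real_normK ?num_real. Qed.

Section InnerProduct.
Context (K : numFieldType) (conj : K -> K) (H : completeNormedModType K).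
Context (dot : {dot H for conj}).

Lemma dot_conj (x y : H) : dot x y = conj (dot y x).
Proof. by rewrite [LHS]hermitian_subproof expr0 mul1r. Qed.

(** The usual argument, with denominators cleared: [w] is [|y|^2] times the
component of [x] orthogonal to [y], and [0 <= |w|^2] is the squared inequality
multiplied by [|y|^2]. *)
Lemma dot_le_norm (hconj : forall a : K, a * conj a = `|a| ^+ 2)
    (hH : hilbert_norm dot) (x y : H) : `|dot x y| <= `|x| * `|y|.
Proof.
have [->|y0] := eqVneq y 0; first by rewrite linear0r !normr0 mulr0.
have yy_gt0 : 0 < `|y| ^+ 2 by rewrite exprn_gt0// normr_gt0.
pose w := dot y y *: x - dot x y *: y.
have wy0 : dot w y = 0.
  by rewrite linearBl /= !linearZl_LR /= [dot x y * _]mulrC subrr.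
have ww : dot w w = dot y y * (dot y y * dot x x - `|dot x y| ^+ 2).
  rewrite {2}/w linearBr /= !linearZr_LR /= wy0 mulr0 subr0 -dot_conj.
  by rewrite linearBl /= !linearZl_LR /= [dot y x]dot_conj hconj.
rewrite -(@ler_pXn2r _ 2)// ?nnegrE ?mulr_ge0// exprMn mulrC -subr_ge0.
by rewrite -(pmulr_rge0 _ yy_gt0) !hH -ww -hH exprn_ge0.
Qed.

(** [P x] and [x - P x] are orthogonal because [P] is self-adjoint and
idempotent, so the cross terms vanish. *)
Lemma dot_proj_split (P : {linear H -> H}) :
  orthogonal_projection dot P -> forall x y : H,
  dot x y = dot (x - P x) (y - P y) + dot (P x) (P y).
Proof.
move=> [PP Psym] x y.
by rewrite linearBl /= !linearBr /= !Psym !PP subrr subr0 subrK.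
Qed.

Context (P : nat -> {linear H -> H}).
Hypothesis hP : forall j : nat, orthogonal_projection dot (P j).

Lemma dot_compl_prod (n : nat) (x y : H) :
  dot x y = dot (compl_prod P n x) (compl_prod P n y) +
            \sum_(0 <= k < n) dot (Q_op P k x) (Q_op P k y).
Proof.
elim: n => [|n IHn]; first by rewrite big_nil addr0.
by rewrite IHn (dot_proj_split (hP n)) big_nat_recr//= -addrA [X in _ + X]addrC.
Qed.

Lemma series_dot_Q_op (x y : H) :
  series (fun k => dot (Q_op P k x) (Q_op P k y)) =
  fun n => dot x y - dot (compl_prod P n x) (compl_prod P n y).
Proof.
by apply/funext => n; rewrite (dot_compl_prod n x y) addrAC subrr add0r.
Qed.

Hypothesis hH : hilbert_norm dot.

Lemma norm_compl_prod (n : nat) (x : H) :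
  `|x| ^+ 2 = `|compl_prod P n x| ^+ 2 + \sum_(0 <= k < n) `|Q_op P k x| ^+ 2.
Proof.
rewrite !hH (dot_compl_prod n); congr (_ + _).
by apply: eq_bigr => k _; rewrite hH.
Qed.

(** [T_op P n] has [n.+1] factors whereas the partial sum of length [n] leaves
the remainder with [n] factors; the shift is harmless in the limit. *)
Lemma strongly_tends_to_0_compl_prod :
  strongly_tends_to_0 (T_op P) <->
  forall x : H, compl_prod P n x @[n --> \oo] --> (0 : H).
Proof.
by split=> h x; have := h x; rewrite -(cvg_shiftS (compl_prod P ^~ x)).
Qed.

Lemma strong_cvg_id_eq_sum (hconj : forall a : K, a * conj a = `|a| ^+ 2) :
  strongly_tends_to_0 (T_op P) -> id_eq_sum_adjoint_mul dot (Q_op P).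
Proof.
move=> /strongly_tends_to_0_compl_prod T0 x y.
suff R0 : dot (compl_prod P n x) (compl_prod P n y) @[n --> \oo] --> (0 : K).
  rewrite series_dot_Q_op -[X in _ --> X]subr0.
  by apply: cvgB => //; exact: cvg_cst.
have N0 : `|compl_prod P n x| * `|compl_prod P n y| @[n --> \oo] --> (0 : K).
  by have := cvgM (cvg_norm (T0 x)) (cvg_norm (T0 y)); rewrite normr0 mulr0; apply.
apply/cvgr0Pnorm_lt => e e0; near=> n.
apply: le_lt_trans (dot_le_norm hconj hH _ _) _.
rewrite -[ltLHS]ger0_norm ?mulr_ge0//.
by near: n; exact: cvgr0_norm_lt N0 _ e0.
Unshelve. all: end_near. Qed.

Lemma id_eq_sum_strong_cvg :
  id_eq_sum_adjoint_mul dot (Q_op P) -> strongly_tends_to_0 (T_op P).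
Proof.
move=> hQ; apply/strongly_tends_to_0_compl_prod => x.
have N0 : `|compl_prod P n x| ^+ 2 @[n --> \oo] --> (0 : K).
  have -> : (fun n => `|compl_prod P n x| ^+ 2) =
            (fun n => dot x x -
               series (fun k => dot (Q_op P k x) (Q_op P k x)) n).
    by apply/funext => n; rewrite series_dot_Q_op subKr hH.
  by rewrite -(subrr (dot x x)); apply: cvgB; [exact: cvg_cst|exact: hQ].
(* An abstract K has no square root function: use e ^+ 2 as the tolerance. *)
apply/cvgr0Pnorm_lt => e e0; near=> n.
rewrite -(@ltr_pXn2r _ 2)// ?nnegrE ?(ltW e0)// -[ltLHS]ger0_norm ?exprn_ge0//.
by near: n; apply: cvgr0_norm_lt N0 _ _; rewrite exprn_gt0.
Unshelve. all: end_near. Qed.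

End InnerProduct.

Theorem theorem7p6 (R : realType) (K : numFieldType) (conj : K -> K)
    (hK : hilbert_scalars R conj)
    (H : completeNormedModType K) (dot : {dot H for conj})
    (hH : hilbert_norm dot)
    (P : nat -> {linear H -> H})
    (hP : forall j : nat, orthogonal_projection dot (P j)) :
  [/\ forall n : nat, (0 < n)%N -> forall x : H,
        `|x| ^+ 2 = `|T_op P n x| ^+ 2 + \sum_(0 <= k < n.+1) `|Q_op P k x| ^+ 2,
      strongly_tends_to_0 (T_op P) <-> id_eq_sum_adjoint_mul dot (Q_op P)
    & id_eq_sum_adjoint_mul dot (Q_op P) ->
        forall x : H, series (fun j => `|Q_op P j x| ^+ 2) @ \oo --> `|x| ^+ 2].
Proof.
have hconj := mul_conj_hilbert_scalars hK.
split=> [n _ x||hQ x]; first exact: norm_compl_prod.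
  by split; [exact: strong_cvg_id_eq_sum|exact: id_eq_sum_strong_cvg].
by rewrite hH; under eq_fun do rewrite hH; exact: hQ.
Qed.
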